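(* Let $D$ be a weighted oriented graph with vertex set $\{x_1,\dots,x_n\}$, let $K$ be a field and let $I(D)\subseteq R=K[x_1,\dots,x_n]$ be the edge ideal of $D$. For an ideal $J$ of $R$ the following conditions are equivalent: 1) $J$ is a minimal irreducible monomial ideal of $I(D)$. 2) There is a strong vertex cover $C$ of $D$ such that $J=I_C$.
   Context: A weighted oriented graph is a triplet $D=(V(D),E(D),w)$ where $V=V(D)$ is a finite set, $E=E(D)\subseteq V\times V$ is the edge set of an oriented graph (no loops, and for $x\neq y$ at most one of $(x,y),(y,x)$ is in $E$), and $w:V\to\mathbb{N}=\{1,2,\dots\}$ is the weight function. Put $V^{+}=\{x\in V: w(x)\neq 1\}$. For $x\in V$: $N_D^{+}(x)=\{y:(x,y)\in E\}$, $N_D^{-}(x)=\{y:(y,x)\in E\}$, $N_D(x)=N_D^+(x)\cup N_D^-(x)$. A source is a vertex $x$ with $N_D(x)=N_D^+(x)$. Standing assumption: if $x$ is a source of $D$, then $w(x)=1$. Vertices are identified with the variables of $R=K[x_1,\dots,x_n]$, $K$ a field. The edge ideal is $I(D)=(x_ix_j^{w(x_j)} : (x_i,x_j)\in E)\subseteq R$. A vertex cover of $D$ is a subset $C\subseteq V$ such that for every $(x,y)\in E$, $x\in C$ or $y\in C$. For a vertex cover $C$, with $C^c=V\setminus C$, define $L_1(C)=\{x\in C: N_D^{+}(x)\cap C^c\neq\emptyset\}$, $L_2(C)=\{x\in C: x\notin L_1(C)\text{ and }N_D^{-}(x)\cap C^c\neq\emptyset\}$, $L_3(C)=C\setminus(L_1(C)\cup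 L_2(C))$. A vertex cover $C$ is strong if for each $x\in L_3(C)$ there is $(y,x)\in E$ such that $y\in L_2(C)\cup L_3(C)$ and $y\in V^{+}$. The irreducible ideal associated to a vertex cover $C$ is $I_C=\bigl(L_1(C)\cup\{x_j^{w(x_j)} : x_j\in L_2(C)\cup L_3(C)\}\bigr)\subseteq R$. An irreducible monomial ideal is an ideal of the form $(x_{i_1}^{a_1},\dots,x_{i_s}^{a_s})$ with distinct variables and positive exponents. An irreducible monomial ideal $\mathfrak q\supseteq I$ is a minimal irreducible monomial ideal of a monomial ideal $I$ if for every irreducible monomial ideal $\mathfrak p$ with $I\subseteq\mathfrak p\subseteq\mathfrak q$ one has $\mathfrak p=\mathfrak q$. *)

(* Defs.v *)
From mathcomp Require Import all_boot all_order all_algebra.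
From mathcomp Require Import boolp classical_sets.
From mathcomp Require Import mpoly.

Set Implicit Arguments.
Unset Strict Implicit.
Unset Printing Implicit Defensive.

Import GRing.Theory.
Local Open Scope ring_scope.

(* The vertex x_i is represented by its index i : 'I_n; as an element of
   {mpoly K[n]} it is 'X_i. *)
Record woGraph (n : nat) := WOGraph {
  edge : rel 'I_n;
  weight : 'I_n -> nat;
  edge_irreflexive : forall x, ~~ edge x x;
  edge_oriented : forall x y, x != y -> ~~ (edge x y && edge y x);
  weight_gt0 : forall x, (0 < weight x)%N
}.

Section Graph.
Variables (n : nat) (D : woGraph n).
Implicit Types (x y : 'I_n) (C : {set 'I_n}).

Definition Vplus : {set 'I_n} := [set x | weight D x != 1%N]%SET.

Definition outN x : {set 'I_n} := [set y | edge D x y]%SET.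
Definition inN x : {set 'I_n} := [set y | edge D y x]%SET.
Definition nbr x : {set 'I_n} := outN x :|: inN x.

(* Isolated vertices are sources. *)
Definition is_source x : bool := nbr x == outN x.

Definition vertex_cover C : bool :=
  [forall x, forall y, edge D x y ==> (x \in C) || (y \in C)].

(* finset.set0 is qualified because classical_sets shadows set0. *)
Definition L1 C : {set 'I_n} :=
  [set x in C | outN x :&: ~: C != finset.set0]%SET.
Definition L2 C : {set 'I_n} :=
  [set x in C | (x \notin L1 C) && (inN x :&: ~: C != finset.set0)]%SET.
Definition L3 C : {set 'I_n} := C :\: (L1 C :|: L2 C).

Definition strong_vertex_cover C : bool :=
  vertex_cover C &&
  [forall x in L3 C,
    exists y, [&& edge D y x, y \in L2 C :|: L3 C & y \in Vplus]].

End Graph.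

Definition is_ideal (A : comNzRingType) (J : set A) : Prop :=
  [/\ J 0,
      (forall p q, J p -> J q -> J (p + q)) &
      (forall a p, J p -> J (a * p))].

Definition ideal_gen (A : comNzRingType) (G : set A) : set A :=
  smallest (@is_ideal A) G.

Section Ideals.
Variables (n : nat) (K : fieldType).
Local Notation R := {mpoly K[n]}.

Definition edge_ideal (D : woGraph n) : set R :=
  ideal_gen
    [set m | exists x y, edge D x y /\ m = 'X_x * 'X_y ^+ weight D y]%classic.

Definition cover_ideal (D : woGraph n) (C : {set 'I_n}) : set R :=
  ideal_gen
    ([set m | exists2 x, x \in L1 D C & m = 'X_x] `|`
     [set m | exists2 x, x \in L2 D C :|: L3 D C & m = 'X_x ^+ weight D x])
    %classic.

(* S is the set of variables involved; S may be empty, so that the zero ideal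
   is irreducible, and is I_C for the empty cover C of a graph with no edge. *)
Definition irreducible_monomial_ideal (q : set R) : Prop :=
  exists (S : {set 'I_n}) (a : 'I_n -> nat),
    (forall i, i \in S -> (0 < a i)%N) /\
    q = ideal_gen [set m | exists2 i, i \in S & m = 'X_i ^+ a i]%classic.

Definition minimal_irreducible_monomial_ideal (I q : set R) : Prop :=
  [/\ irreducible_monomial_ideal q,
      (I `<=` q)%classic &
      forall p : set R, irreducible_monomial_ideal p ->
        (I `<=` p)%classic -> (p `<=` q)%classic -> p = q].

End Ideals.

Arguments edge_ideal {n} K D _.
Arguments cover_ideal {n} K D C _.

(* Main.v *)
(** Write [(S, a)] for the ideal generated by the [x_i ^ a_i] with [i] in [S].
    A monomial [x ^ m] lies in it iff [a_i <= m_i] for some [i] in [S], so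
    inclusions between such ideals, and the inclusion of [I(D)], are statements
    about exponents: [I(D)] is included in [(S, a)] iff every edge [(x, y)] has
    [x] in [S] with [a_x <= 1], or [y] in [S] with [a_y <= w(y)].
    If [(S, a)] is minimal, replacing [a_x] by [a_x + 1] must violate some edge
    at [x]; this forces [a_x = 1] on [L1(S)], [a_x = w(x)] elsewhere, and, on
    [L3(S)], provides the in-neighbour required of a strong cover.  Conversely
    the edges that witness membership in [L1], [L2] and strongness on [L3]
    forbid any ideal [(T, b)] between [I(D)] and [I_C] other than [I_C]. *)

Require Import Defs.
From mathcomp Require Import all_boot all_order all_algebra.
From mathcomp Require Import boolp classical_sets.
From mathcomp Require Import mpoly.

Set Implicit Arguments.
Unset Strict Implicit.
Unset Printing Implicit Defensive.

Import GRing.Theory.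

(** * Ideals generated by a set *)

Section IdealGen.
Local Open Scope ring_scope.
Variable A : comNzRingType.
Implicit Types G J : set A.

Lemma ideal_gen_is_ideal G : is_ideal (ideal_gen G).
Proof.
split.
- by move=> J [[]].
- by move=> p q Gp Gq J [idJ GJ]; case: (idJ) => _ + _; apply;
    [apply: Gp | apply: Gq].
- by move=> c p Gp J [idJ GJ]; case: (idJ) => _ _; apply; apply: Gp.
Qed.

Lemma sub_ideal_gen G : (G `<=` ideal_gen G)%classic.
Proof. by move=> p Gp J [_]; apply. Qed.

Lemma ideal_gen_sub G J : is_ideal J ->
  (ideal_gen G `<=` J)%classic <-> (G `<=` J)%classic.
Proof.
move=> idJ; split=> [GJ p Gp | GJ p Gp]; last exact: Gp.
exact: GJ (sub_ideal_gen Gp).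
Qed.

End IdealGen.

(** * Irreducible monomial ideals in terms of exponents *)

Section IrreducibleIdeals.
Local Open Scope ring_scope.
Variables (n : nat) (K : fieldType).
Local Notation R := {mpoly K[n]}.
Implicit Types (S T : {set 'I_n}) (a b : 'I_n -> nat) (m : 'X_{1..n}).

Definition irr_ideal S a : set R :=
  ideal_gen [set m | exists2 i, i \in S & m = 'X_i ^+ a i]%classic.

Lemma irr_ideal_is_ideal S a : is_ideal (irr_ideal S a).
Proof. exact: ideal_gen_is_ideal. Qed.

(** The polynomials whose support monomials are each divisible by some generator form an ideal [P]
    containing the generators, hence [irr_ideal S a]; the support of ['X_[m]] is [m] alone. *)
Lemma mem_irr_ideal S a m :
  irr_ideal S a 'X_[m] <-> exists2 i, i \in S & (a i <= m i)%N.
Proof.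
split=> [|[i iS le_ai]]; last first.
  have le_m : (U_(i) *+ a i <= m)%MM.
    apply/mnm_lepP => j; rewrite mulmnE mnm1E.
    by case: eqP => [<-|_]; rewrite ?mul1n ?mul0n.
  rewrite -(submK le_m) mpolyXD -mpolyXn.
  have [_ _] := irr_ideal_is_ideal S a; apply.
  by apply: sub_ideal_gen; exists i.
pose P : set R :=
  [set p | forall m, m \in msupp p -> exists2 i, i \in S & (a i <= m i)%N]%classic.
have idP : is_ideal P.
  split=> [m' | p q Pp Pq m' | c p Pp m'].
  - by rewrite msupp0.
  - by move/msuppD_le; rewrite mem_cat => /orP[/Pp | /Pq].
  - move/msuppM_le => /allpairsP[[m1 m2] /= [_ /Pp[i iS le_ai] ->]].
    by exists i => //; rewrite mnmDE (leq_trans le_ai) ?leq_addl.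
suff sP : (irr_ideal S a `<=` P)%classic.
  by move/sP; apply; rewrite msuppX inE.
apply/(ideal_gen_sub _ idP) => _ [i iS ->] m'.
rewrite mpolyXn msuppX inE => /eqP ->; exists i => //.
by rewrite mulmnE mnm1E eqxx mul1n.
Qed.

(** It suffices to test generators. A power of [x_i] has exponent 0 at every [j] other than [i], so
    positivity of [b] leaves only the generator in [x_i] to divide it. *)
Lemma irr_ideal_sub S a T b : {in T, forall i, 0 < b i}%N ->
  (irr_ideal S a `<=` irr_ideal T b)%classic <->
  {in S, forall i, (i \in T) && (b i <= a i)%N}.
Proof.
move=> b_gt0; rewrite (ideal_gen_sub _ (irr_ideal_is_ideal T b)).
split=> [sST i iS | sST _ [i iS ->]]; last first.
  have /andP[iT le_ba] := sST i iS.
  rewrite mpolyXn; apply/mem_irr_ideal; exists i => //.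
  by rewrite mulmnE mnm1E eqxx mul1n.
have : irr_ideal T b ('X_i ^+ a i) by apply: sST; exists i.
rewrite mpolyXn => /mem_irr_ideal[j jT].
rewrite mulmnE mnm1E; case: eqP => [-> | _]; first by rewrite mul1n jT.
by rewrite leqNgt b_gt0.
Qed.

Lemma eq_irr_ideal S a b : {in S, a =1 b} -> irr_ideal S a = irr_ideal S b.
Proof.
move=> eq_ab; congr ideal_gen; apply/predeqP => p.
by split=> -[i iS ->]; exists i; rewrite ?eq_ab.
Qed.

End IrreducibleIdeals.

Arguments irr_ideal {n} K S a _.

(** * Edge ideals, cover ideals and strong covers *)

Section CoverIdeals.
Variables (n : nat) (K : fieldType) (D : woGraph n).
Implicit Types (S T C : {set 'I_n}) (a b : 'I_n -> nat) (x y : 'I_n).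

(** For positive [a] and an edge [(x, y)], this is membership of its generator in [irr_ideal S a]:
    each disjunct names a power that may divide it. *)
Definition covers_edge S a x y : bool :=
  (x \in S) && (a x <= 1) || (y \in S) && (a y <= weight D y).

Lemma edge_ideal_sub S a : {in S, forall i, 0 < a i} ->
  (edge_ideal K D `<=` irr_ideal K S a)%classic <->
  forall x y, edge D x y -> covers_edge S a x y.
Proof.
move=> a_gt0; rewrite (ideal_gen_sub _ (irr_ideal_is_ideal K S a)).
split=> [sDS x y xy | cov _ [x [y [xy ->]]]].
  have: irr_ideal K S a ('X_x * 'X_y ^+ weight D y)%R.
    by apply: sDS; exists x, y.
  rewrite mpolyXn -mpolyXD => /mem_irr_ideal[i iS].
  rewrite mnmDE mulmnE !mnm1E; have [eq_xi | _] := eqVneq x i.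
    (* As there are no loops, the exponent of the generator at its tail is exactly 1. *)
    have /negPf-> : y != i.
      by apply: contraL xy => /eqP->; rewrite eq_xi edge_irreflexive.
    by rewrite mul0n addn0 /covers_edge eq_xi iS => ->.
  have [eq_yi | _] := eqVneq y i.
    by rewrite add0n mul1n /covers_edge eq_yi iS => ->; rewrite orbT.
  by rewrite leqNgt a_gt0.
rewrite mpolyXn -mpolyXD; apply/mem_irr_ideal.
have /orP[/andP[xS le_a] | /andP[yS le_a]] := cov _ _ xy.
  by exists x; rewrite // mnmDE mnm1E eqxx (leq_trans le_a) ?leq_addr.
exists y; rewrite // mnmDE mulmnE !mnm1E eqxx mul1n.
by rewrite (leq_trans le_a) ?leq_addl.
Qed.

Definition cover_exp C x : nat := if x \in L1 D C then 1 else weight D x.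

Lemma cover_exp_gt0 C x : 0 < cover_exp C x.
Proof. by rewrite /cover_exp; case: ifP => // _; apply: weight_gt0. Qed.

Lemma cover_exp_le C x : cover_exp C x <= weight D x.
Proof. by rewrite /cover_exp; case: ifP => // _; apply: weight_gt0. Qed.

Lemma mem_Vplus x : (x \in Vplus D) = (weight D x != 1).
Proof. by rewrite inE. Qed.

Lemma mem_L1 C x :
  (x \in L1 D C) = (x \in C) && [exists y, edge D x y && (y \notin C)].
Proof.
rewrite inE; congr (_ && _).
by apply/set0Pn/existsP => -[y]; rewrite ?inE => xy; exists y; rewrite ?inE.
Qed.

Lemma mem_L2 C x :
  (x \in L2 D C) =
  [&& x \in C, x \notin L1 D C & [exists y, edge D y x && (y \notin C)]].
Proof.
rewrite inE; do 2!congr (_ && _).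
by apply/set0Pn/existsP => -[y]; rewrite ?inE => xy; exists y; rewrite ?inE.
Qed.

Lemma mem_L23 C x :
  (x \in L2 D C :|: L3 D C) = (x \in C) && (x \notin L1 D C).
Proof.
rewrite [L3 _ _]/L3 finset.in_setU finset.in_setD finset.in_setU mem_L2.
move: [exists y, _] => e.
by case: (x \in C); case: (x \in L1 _ _); case: e.
Qed.

Lemma mem_L3 C x :
  (x \in L3 D C) = [&& x \in C, x \notin L1 D C & x \notin L2 D C].
Proof. by rewrite finset.in_setD finset.in_setU negb_or andbC andbA. Qed.

Lemma cover_idealE C : cover_ideal K D C = irr_ideal K C (cover_exp C).
Proof.
congr ideal_gen; apply/predeqP => p; split=> [[[x] | [x]] | [x xC ->]].
- move=> xL1 ->; exists x; first by move: xL1; rewrite mem_L1 => /andP[].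
  by rewrite /cover_exp xL1 expr1.
- rewrite mem_L23 => /andP[xC /negPf xL1] ->.
  by exists x; rewrite // /cover_exp xL1.
- rewrite /cover_exp; case: ifP => xL1; [left | right]; exists x => //.
  by rewrite mem_L23 xC xL1.
Qed.

Lemma strong_coverP C : reflect
  [/\ vertex_cover D C &
      {in L3 D C, forall x, exists y,
        [/\ edge D y x, y \in C, y \notin L1 D C & weight D y != 1]}]
  (strong_vertex_cover D C).
Proof.
apply: (iffP andP) => -[covC strC]; split=> //.
  move=> x xL3; have /existsP[y] := forall_inP strC x xL3.
  by rewrite mem_L23 mem_Vplus => /and3P[yx /andP[yC yL1] wy]; exists y.
apply/forall_inP => x /strC[y [yx yC yL1 wy]]; apply/existsP; exists y.
by rewrite mem_L23 mem_Vplus yx yC yL1.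
Qed.

(** A head in [C] has exponent at most its weight; a head outside [C] puts the tail in [L1], where
    the exponent is 1. *)
Lemma cover_exp_covers C : vertex_cover D C ->
  forall x y, edge D x y -> covers_edge C (cover_exp C) x y.
Proof.
move=> covC x y xy; rewrite /covers_edge cover_exp_le andbT orbC.
have [//|yC] := boolP (y \in C).
have /implyP/(_ xy) := forallP (forallP covC x) y.
rewrite (negPf yC) orbF /= => xC; rewrite xC /cover_exp ifT //.
by rewrite mem_L1 xC; apply/existsP; exists y; rewrite xy.
Qed.

(** Each [x] in [C] has an edge that [T] can cover only at [x]. On [L1] and [L2] its other end is
    outside [C], hence outside [T]. On [L3] it comes from the in-neighbour [y] given by strongness:
    covering at [y] needs [b y <= 1], whereas [b y >= w(y) > 1]. *)
Lemma strong_cover_minimal C T b : strong_vertex_cover D C ->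
    {in T, forall x, (x \in C) && (cover_exp C x <= b x)} ->
    (forall x y, edge D x y -> covers_edge T b x y) ->
  {in C, forall x, (x \in T) && (b x <= cover_exp C x)}.
Proof.
case/strong_coverP=> _ strC sTC cov x xC.
have notT y : y \notin C -> y \notin T by apply: contra => /sTC/andP[].
rewrite /cover_exp; have [xL1 | xL1] := boolP (x \in L1 D C).
  move: (xL1); rewrite mem_L1 => /andP[_ /existsP[y /andP[xy /notT yT]]].
  by move: (cov _ _ xy); rewrite /covers_edge (negPf yT) orbF.
have [xL2 | xL2] := boolP (x \in L2 D C).
  move: (xL2); rewrite mem_L2 => /and3P[_ _ /existsP[y /andP[yx /notT yT]]].
  by move: (cov _ _ yx); rewrite /covers_edge (negPf yT).
have [|y [yx yC yL1 wy]] := strC x; first by rewrite mem_L3 xC xL1.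
case/orP: (cov _ _ yx) => // /andP[/sTC/andP[_]].
rewrite /cover_exp (negPf yL1) => le_wb le_b1.
by case/negP: wy; rewrite eqn_leq weight_gt0 (leq_trans le_wb).
Qed.

(* Otherwise raising the exponent of [x] by one keeps every edge covered. *)
Lemma minimal_tight_edge S a x :
    {in S, forall i, 0 < a i} ->
    minimal_irreducible_monomial_ideal (edge_ideal K D) (irr_ideal K S a) ->
    x \in S ->
  (a x = 1 /\ exists2 y, edge D x y & ~~ ((y \in S) && (a y <= weight D y))) \/
  (a x = weight D x /\ exists2 y, edge D y x & ~~ ((y \in S) && (a y <= 1))).
Proof.
move=> a_gt0 [_ /(edge_ideal_sub a_gt0) cov minS] xS.
pose b i := if i == x then (a i).+1 else a i.
have b_gt0 : {in S, forall i, 0 < b i}.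
  by move=> i iS; rewrite /b; case: ifP => // _; apply: a_gt0.
have ltab : a x < b x by rewrite /b eqxx.
have le_ab i : a i <= b i by rewrite /b; case: ifP.
have [covb | ] := pselect (forall u v, edge D u v -> covers_edge S b u v).
  have sba : (irr_ideal K S b `<=` irr_ideal K S a)%classic.
    by apply/irr_ideal_sub => // i iS; rewrite iS le_ab.
  have eq_ba : irr_ideal K S b = irr_ideal K S a.
    by apply: minS => //; [exists S, b | apply/edge_ideal_sub].
  have : (irr_ideal K S a `<=` irr_ideal K S b)%classic by rewrite eq_ba.
  by move/(irr_ideal_sub _ _ _ b_gt0)/(_ x xS); rewrite xS leqNgt ltab.
(* The edge [(u, v)] is covered by [a] but not by [b], so [x] is one of its ends: the tail gives the
   first alternative, the head the second. *)
move/existsNP=> [u /existsNP[v /not_implyP[uv /negP]]].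
rewrite negb_or => /andP[]; rewrite /b.
have neq_uv : u != v.
  by apply: contraL uv => /eqP->; apply: edge_irreflexive.
have [eq_ux _ | neq_ux] := eqVneq u x; have [eq_vx | neq_vx] := eqVneq v x.
- by case/eqP: neq_uv; rewrite eq_ux.
- move=> nv; left; have := cov _ _ uv.
  rewrite /covers_edge (negPf nv) orbF eq_ux xS /= => le_a1; split; last first.
    by exists v; rewrite // -eq_ux.
  by apply/eqP; rewrite eqn_leq le_a1 a_gt0.
- move=> nu nv; right; have := cov _ _ uv.
  rewrite /covers_edge (negPf nu) eq_vx xS /= => le_aw; split; last first.
    by exists u; rewrite // -eq_vx.
  (* Here [a x <= w(x) < a x + 1]. *)
  by apply/eqP; move: nv; rewrite eq_vx xS -ltnNge ltnS eqn_leq le_aw.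
- by move=> nu nv; move: (cov _ _ uv); rewrite /covers_edge (negPf nu) (negPf nv).
Qed.

Lemma minimal_strong_cover S a :
    {in S, forall i, 0 < a i} ->
    minimal_irreducible_monomial_ideal (edge_ideal K D) (irr_ideal K S a) ->
  strong_vertex_cover D S /\ {in S, a =1 cover_exp S}.
Proof.
move=> a_gt0 minS; have tight x := minimal_tight_edge a_gt0 minS (x := x).
case: (minS) => _ /(edge_ideal_sub a_gt0) cov _.
have le_aw x : x \in S -> a x <= weight D x.
  by case/tight=> -[-> _] //; apply: weight_gt0.
have aL1 x : x \in L1 D S -> a x = 1.
  rewrite mem_L1 => /andP[xS /existsP[y /andP[xy /negPf yS]]].
  have := cov _ _ xy; rewrite /covers_edge xS yS orbF /= => le_a1.
  by apply/eqP; rewrite eqn_leq le_a1 a_gt0.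
have aL23 x : x \in S -> x \notin L1 D S ->
    a x = weight D x /\ exists2 y, edge D y x & ~~ ((y \in S) && (a y <= 1)).
  (* A tight out-edge ends outside [S], since [a y <= w(y)] on [S]; this would put [x] in [L1]. *)
  move=> xS xL1; case: (tight x xS) => // -[_ [y xy ny]]; case/negP: xL1.
  rewrite mem_L1 xS; apply/existsP; exists y; rewrite xy.
  by apply: contra ny => yS; rewrite yS le_aw.
have aE : {in S, a =1 cover_exp S}.
  move=> x xS; rewrite /cover_exp; case: ifPn => [/aL1 // | xL1].
  by case: (aL23 x xS xL1).
split=> //; apply/strong_coverP; split.
  apply/forallP => x; apply/forallP => y; apply/implyP => /cov.
  by case/orP=> /andP[->]; rewrite ?orbT.
move=> x; rewrite mem_L3 => /and3P[xS xL1 xL2].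
have [_ [y yx ny]] := aL23 x xS xL1.
(* Otherwise the edge [(y, x)] would put [x] in [L2]. *)
have yS : y \in S.
  apply: contraR xL2 => yS; rewrite mem_L2 xS xL1.
  by apply/existsP; exists y; rewrite yx.
(* Tightness of [(y, x)] rules out exponent 1 at [y]; so [y] avoids [L1] and [w(y) = a y > 1]. *)
have a_gt1 : 1 < a y by move: ny; rewrite yS ltnNge.
have yL1 : y \notin L1 D S by apply: contraL a_gt1 => /aL1->.
exists y; split=> //; have [<- _] := aL23 y yS yL1.
by rewrite neq_ltn a_gt1 orbT.
Qed.

End CoverIdeals.

Theorem theorem3p10 (n : nat) (K : fieldType) (D : woGraph n)
    (source_weight1 : forall x : 'I_n, is_source D x -> weight D x = 1)
    (J : set {mpoly K[n]}) (J_ideal : is_ideal J) :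
  minimal_irreducible_monomial_ideal (edge_ideal K D) J <->
  exists C : {set 'I_n}, strong_vertex_cover D C /\ J = cover_ideal K D C.
Proof.
split=> [minJ | [C [strC ->]]].
  case: (minJ) => -[S [a [a_gt0 defJ]]] _ _.
  rewrite -/(irr_ideal K S a) in defJ; rewrite defJ in minJ *.
  have [strS aE] := minimal_strong_cover a_gt0 minJ.
  by exists S; rewrite cover_idealE (eq_irr_ideal _ aE).
have e_gt0 : {in C, forall x, 0 < cover_exp D C x}.
  by move=> x _; apply: cover_exp_gt0.
have [covC _] := andP strC; rewrite cover_idealE; split.
- by exists C, (cover_exp D C).
- exact/edge_ideal_sub/cover_exp_covers.
move=> _ [T [b [b_gt0 ->]]]; rewrite -/(irr_ideal K T b).
move=> /(edge_ideal_sub _ _ b_gt0) covT sTC; apply/seteqP; split=> //.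
(* The remaining inclusion, of [I_C] in the ideal of [(T, b)], is a comparison of exponents. *)
apply/irr_ideal_sub => //; apply: strong_cover_minimal strC _ covT.
exact/(irr_ideal_sub K _ _ e_gt0).
Qed.
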